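(* Let $\mathbf{E}$ be a Euclidean space, let $f\colon\mathbf{E}\to\overline{\mathbf{R}}$ be a lower semicontinuous, prox-bounded function, and let $x\in\mathbf{E}$ be a point with $f(x)$ finite. Fix a vector $v\in\mathbf{E}$ and define $\varphi\colon[0,\infty)\to\overline{\mathbf{R}}$ by $\varphi(\alpha):=f_{\alpha}(x+\alpha v)$. Then the following are true. (i) The vector $v$ lies in the Fréchet subdifferential $\hat{\partial}f(x)$ if and only if $$\varphi'_+(0)=\frac{|v|^2}{2}$$ (meaning that the one-sided derivative exists and has this value). (ii) The vector $v$ lies in the proximal subdifferential $\partial_p f(x)$ if and only if there exists $\alpha>0$ satisfying $x\in P_{\alpha}f(x+\alpha v)$, or equivalently $$\varphi(\alpha)=f(x)+\frac{|v|^2}{2}\alpha.$$ In this case, the equation above continues to hold with $\alpha$ replaced by any $\tilde{\alpha}\in[0,\alpha]$.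
   Context: A Euclidean space is a finite-dimensional real inner product space with inner product $\langle\cdot,\cdot\rangle$ and induced norm $|\cdot|$. $\overline{\mathbf{R}}=\mathbf{R}\cup\{\pm\infty\}$. A function $f\colon\mathbf{E}\to\overline{\mathbf{R}}$ is prox-bounded if it majorizes some quadratic function (i.e. $f\ge q$ on $\mathbf{E}$ for some real quadratic function $q$). For $\alpha>0$, the Moreau envelope and proximal mapping are $$f_\alpha(z):=\inf_{y\in\mathbf{E}}\Big\{f(y)+\tfrac1{2\alpha}|y-z|^2\Big\},\qquad P_\alpha f(z):=\operatorname*{argmin}_{y\in\mathbf{E}}\Big\{f(y)+\tfrac1{2\alpha}|y-z|^2\Big\},$$ and $f_0:=f$. For $\varphi\colon[0,\infty)\to\overline{\mathbf{R}}$, the one-sided derivative is $\varphi'_+(0):=\lim_{\alpha\searrow0}\frac{\varphi(\alpha)-\varphi(0)}{\alpha}$. For $\bar x$ with $f(\bar x)$ finite: the proximal subdifferential $\partial_p f(\bar x)$ consists of all $v\in\mathbf{E}$ for which there exist $r>0$ and $\varepsilon>0$ with $f(x)\ge f(\bar x)+\langle v,x-\bar x\rangle-\frac r2|x-\bar x|^2$ whenever $|x-\bar x|\le\varepsilon$; the Fréchet subdifferential $\hat\partial f(\bar x)$ consists of all $v\in\mathbf{E}$ with $f(x)\ge f(\bar x)+\langle v,x-\bar x\rangle+o(|x-\bar x|)$ as $x\to\bar x$. *)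

(* Defs.v *)
From HB Require Import structures.
From mathcomp Require Import all_boot all_order all_algebra.
From mathcomp Require Import all_classical all_reals all_analysis.

Set Implicit Arguments.
Unset Strict Implicit.
Unset Printing Implicit Defensive.

Import Order.TTheory GRing.Theory Num.Theory.
Import numFieldNormedType.Exports.

Local Open Scope classical_set_scope.
Local Open Scope ring_scope.

(* Finite dimension comes from Vector, the topology from NormedModule; the norm
   is the one induced by the inner product. *)
#[short(type="normedVectType")]
HB.structure Definition NormedVector (R : realType) :=
  {E of NormedModule R E & Vector R E}.

HB.mixin Record isEuclidean (R : realType) E of NormedVector R E := {
  inner : {dot E for idfun};
  innerE : forall u : E, inner u u = `|u| ^+ 2
}.

#[short(type="euclideanType")]
HB.structure Definition Euclidean (R : realType) :=
  {E of NormedVector R E & isEuclidean R E}.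

Section variational.
Context {R : realType} {E : euclideanType R}.
Implicit Types (f : E -> \bar R) (q : E -> R) (x z v : E) (alpha : R).

Definition quadratic q :=
  exists (B : {biscalar E}) (l : {scalar E}) (c : R),
    forall y, q y = B y y + l y + c.

Definition prox_bounded f :=
  exists2 q, quadratic q & forall y, ((q y)%:E <= f y)%E.

Definition prox_objective f alpha z : E -> \bar R :=
  fun y => (f y + ((2 * alpha)^-1 * `|y - z| ^+ 2)%:E)%E.

(* Meaningful for 0 <= alpha only. *)
Definition moreau_env f alpha z : \bar R :=
  if alpha == 0 then f z else ereal_inf (range (prox_objective f alpha z)).

Definition argmin (T : Type) (g : T -> \bar R) : set T :=
  [set y | forall y', (g y <= g y')%E].

Definition prox_map f alpha z : set E := argmin (prox_objective f alpha z).

(* Both subdifferentials are meaningful only where f is finite. *)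
Definition prox_subdiff f x : set E :=
  [set v | exists r eps : R, [/\ 0 < r, 0 < eps &
    forall y, `|y - x| <= eps ->
      (f x + (inner v (y - x) - r / 2 * `|y - x| ^+ 2)%:E <= f y)%E]].

Definition frechet_subdiff f x : set E :=
  [set v | exists2 h : E -> R^o, h =o_x (fun y => `|y - x| : R^o) &
    \forall y \near x, (f x + (inner v (y - x) + h y)%:E <= f y)%E].

End variational.

Definition has_right_derivative0 {R : realType} (phi : R -> \bar R)
    (d : \bar R) : Prop :=
  ((phi a - phi 0%R) * (a^-1)%:E)%E @[a --> 0^'+] --> d.

(* Main.v *)
(* Expanding the square gives
     phi(a) = f x + |v|^2 / 2 * a
              + inf_w (f (x + w) - f x - <v, w> + |w|^2 / (2 a)),
   and the infimum is <= 0 (take w = 0). Hence v is a proximal (resp. Frechet)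
   subgradient exactly when, as a decreases to 0, the infimum vanishes (resp.
   is o(a)). Prox-boundedness handles w away from 0: outside any ball around x,
   f lies above y |-> c + <v, y - x> - K |y - x|^2 for some K. Near 0, the
   Frechet case rests on trading s |w| against |w|^2 / (2 a) + s^2 a / 2. *)
Require Import Defs.
From HB Require Import structures.
From mathcomp Require Import all_boot all_order all_algebra.
From mathcomp Require Import all_classical all_reals all_analysis.
From mathcomp Require Import ring lra.
Set Implicit Arguments.
Unset Strict Implicit.
Unset Printing Implicit Defensive.
Import Order.TTheory GRing.Theory Num.Theory.
Import numFieldNormedType.Exports.
Local Open Scope classical_set_scope.
Local Open Scope ring_scope.

(** * Linear algebra in a Euclidean space: Cauchy-Schwarz, Riesz representation, growth of quadratic
    functions *)

Lemma injective_linear_surj (K : fieldType) (U V : vectType K)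
    (T : {linear U -> V}) : injective T -> \dim {:U} = \dim {:V} ->
  forall y, exists x, T x = y.
Proof.
move=> T_inj dimE y.
have ker0 : lker (linfun T) == 0%VS.
  by apply/lker0P => u w; rewrite !lfunE; exact: T_inj.
have imgT : limg (linfun T) = fullv.
  apply/eqP; rewrite eqEdim subvf /= limg_dim_eq ?dimE //.
  by rewrite (eqP ker0) capv0.
have /memv_imgP[u _ yE] : y \in limg (linfun T) by rewrite imgT memvf.
by exists u; rewrite yE lfunE.
Qed.

Section euclidean.
Context {R : realType} {E : euclideanType R}.
Implicit Types (u w z : E) (a : R).

Lemma innerC u w : inner u w = inner w u.
Proof. by rewrite hermC /= expr0 mul1r. Qed.

Lemma innerBl u w z : inner (u - w) z = inner u z - inner w z.
Proof. exact: linearBl. Qed.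

Lemma innerBr u w z : inner z (u - w) = inner z u - inner z w.
Proof. exact: linearBr. Qed.

Lemma innerDr u w z : inner z (u + w) = inner z u + inner z w.
Proof. exact: linearDr. Qed.

Lemma innerNl u w : inner (- u) w = - inner u w.
Proof. exact: linearNl. Qed.

Lemma innerZl a u w : inner (a *: u) w = a * inner u w.
Proof. exact: linearZl_LR. Qed.

Lemma innerZr a u w : inner w (a *: u) = a * inner w u.
Proof. exact: linearZr_LR. Qed.

Lemma inner_suml I (r : seq I) (F : I -> E) w :
  inner (\sum_(i <- r) F i) w = \sum_(i <- r) inner (F i) w.
Proof. exact: linear_sumlz. Qed.

Lemma normB_sqr u w : `|u - w| ^+ 2 = `|u| ^+ 2 - 2 * inner w u + `|w| ^+ 2.
Proof.
rewrite -!innerE innerBl !innerBr (innerC u w); ring.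
Qed.

(* Polarization turns the triangle inequality into Cauchy-Schwarz. *)
Lemma inner_le u w : inner u w <= `|u| * `|w|.
Proof.
have : `|u - - w| ^+ 2 <= (`|u| + `|w|) ^+ 2.
  by rewrite lerXn2r ?nnegrE ?addr_ge0 // opprK ler_normD.
rewrite normB_sqr innerNl normrN (innerC w); nra.
Qed.

Lemma ler_norm_inner u w : `|inner u w| <= `|u| * `|w|.
Proof.
by rewrite ler_norml inner_le andbT lerNl -innerNl -(normrN u) inner_le.
Qed.

(** Pairing with a basis is injective: a vector orthogonal to the whole basis is orthogonal to
    itself. By dimension it is onto, so some [u] pairs with the basis as [l] does. Cauchy-Schwarz
    then bounds every linear form. *)
Lemma riesz (l : {scalar E}) : exists u, forall w, l w = inner w u.
Proof.
pose n := \dim {:E}; pose b := vbasis {:E}.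
pose T (u : E) : 'rV[R]_n := \row_i inner b`_i u.
have T_lin : linear T.
  move=> a u w; apply/rowP => i; rewrite !mxE.
  by rewrite innerDr innerZr.
pose TL := GRing.isLinear.Build R E _ _ T T_lin.
pose Tl : {linear E -> 'rV[R]_n} := HB.pack T TL.
have expand w : w = \sum_i coord b i w *: b`_i.
  by apply: coord_vbasis; rewrite memvf.
have T_inj : injective Tl.
  move=> u w /rowP Tuw; apply/eqP; rewrite -subr_eq0 -normr_eq0 -sqrf_eq0.
  rewrite -innerE {1}(expand (u - w)) inner_suml big1 // => i _.
  by rewrite innerZl innerBr; have := Tuw i; rewrite !mxE => ->; rewrite subrr mulr0.
have dimE : \dim {:E} = \dim {: 'rV[R]_n} by rewrite [RHS]dimvf /dim /= mul1n.
have [u /rowP lu] := injective_linear_surj T_inj dimE (\row_i l b`_i).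
exists u => w; rewrite (expand w) linear_sum inner_suml.
apply: eq_bigr => i _; rewrite linearZ innerZl /=; congr (_ * _).
by have := lu i; rewrite !mxE.
Qed.

Lemma scalar_bounded (l : {scalar E}) :
  exists2 C, 0 <= C & forall w, `|l w| <= C * `|w|.
Proof.
have [u lE] := riesz l; exists `|u| => // w.
by rewrite lE mulrC ler_norm_inner.
Qed.

(** Expanding only the first argument on a basis writes the form as a sum of products of two linear
    forms in [w], each already bounded by a multiple of the norm. *)
Lemma biscalar_bounded (B : {biscalar E}) :
  exists2 C, 0 <= C & forall w, `|B w w| <= C * `|w| ^+ 2.
Proof.
pose b := vbasis {:E}; pose n := \dim {:E}.
have cb (i : 'I_n) : exists C, 0 <= C /\ forall w, `|coord b i w| <= C * `|w|.
  by have [C] := scalar_bounded (coord b i); exists C.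
have Bb (i : 'I_n) : exists C, 0 <= C /\ forall w, `|B b`_i w| <= C * `|w|.
  by have [C] := scalar_bounded (B b`_i); exists C.
have [C1 C1P] := choice cb; have [C2 C2P] := choice Bb.
exists (\sum_i C1 i * C2 i) => [|w].
  by apply: sumr_ge0 => i _; rewrite mulr_ge0 ?(C1P i).1 ?(C2P i).1.
have {1}-> : w = \sum_i coord b i w *: b`_i.
  by apply: coord_vbasis; rewrite memvf.
rewrite linear_sumlz mulr_suml (le_trans (ler_norm_sum _ _ _))//.
apply: ler_sum => i _; rewrite linearZl /= normrM expr2 mulrACA.
by apply: ler_pM; rewrite ?(C1P i).2 ?(C2P i).2.
Qed.

Lemma quadratic_minorant (q : E -> R) (x : E) : quadratic q ->
  exists2 C, 0 <= C & forall y, - (C * (1 + `|y - x| ^+ 2)) <= q y.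
Proof.
move=> [B [l [c qE]]].
have [C1 C1_ge0 BC] := biscalar_bounded B.
have [C2 C2_ge0 lC] := scalar_bounded l.
(* One summand for each part of [q]. With W = |y - x| and X = |x|, |y|^2 <= 2 W^2 + 2 X^2 serves the
   bilinear part, and |y| <= W + X together with W <= 1 + W^2 the linear part. *)
exists (2 * C1 * (1 + `|x| ^+ 2) + C2 * (1 + `|x|) + `|c|) => [|y].
  by rewrite !addr_ge0 // !mulr_ge0 // addr_ge0 // sqr_ge0.
rewrite qE.
have := BC y; have := lC y; rewrite !ler_norml => /andP[ly _] /andP[By _].
have := ler_normD (y - x) x; rewrite subrK.
have : - `|c| <= c by rewrite lerNnormlW.
move: `|y| `|y - x| `|x| `|c| (normr_ge0 y) (normr_ge0 (y - x)) (normr_ge0 x) (normr_ge0 c) ly By.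
move=> Y W X D Y0 W0 X0 D0 ly By cD YWX.
have Y2 : Y ^+ 2 <= 2 * W ^+ 2 + 2 * X ^+ 2.
  have : Y ^+ 2 <= (W + X) ^+ 2 by rewrite lerXn2r // nnegrE addr_ge0.
  have : 0 <= (W - X) ^+ 2 by rewrite sqr_ge0.
  rewrite sqrrB sqrrD; lra.
have XW2 : 0 <= X ^+ 2 * W ^+ 2 by rewrite mulr_ge0 // sqr_ge0.
have H1 : C1 * Y ^+ 2 <= 2 * C1 * (1 + X ^+ 2) * (1 + W ^+ 2).
  have -> : 2 * C1 * (1 + X ^+ 2) * (1 + W ^+ 2) =
            C1 * (2 * (1 + X ^+ 2) * (1 + W ^+ 2)) by ring.
  apply: ler_wpM2l => //; lra.
have H2 : C2 * Y <= C2 * (1 + X) * (1 + W ^+ 2).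
  rewrite -mulrA; apply: ler_wpM2l => //.
  have : 0 <= X * W ^+ 2 by rewrite mulr_ge0 // sqr_ge0.
  have : 0 <= (W - 1) ^+ 2 by rewrite sqr_ge0.
  rewrite sqrrB; lra.
have H3 : 0 <= D * W ^+ 2 by rewrite mulr_ge0 // sqr_ge0.
lra.
Qed.

End euclidean.

(** * Envelope bounds and subgradients as minorization by quadratics *)

Section variational.
Context {R : realType} {E : euclideanType R}.
Implicit Types (f : E -> \bar R) (x y v : E) (a c : R).

Lemma prox_bounded_minorant f x v c d : prox_bounded f -> 0 < d ->
  exists2 K, 0 < K & forall y, d <= `|y - x| ->
    ((c + inner v (y - x) - K * `|y - x| ^+ 2)%:E <= f y)%E.
Proof.
move=> [q /(quadratic_minorant x)[C C_ge0 qC] qf] d_gt0.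
(* Since |y - x| >= d, dividing by d^2 absorbs constants into |y - x|^2 and dividing by d absorbs
   the linear term; the final 1 makes the coefficient positive. *)
exists (C + `|v| / d + (C + `|c|) / d ^+ 2 + 1) => [|y dy].
  by rewrite ltr_wpDl // !addr_ge0 // divr_ge0 ?addr_ge0 ?sqr_ge0 // ltW.
apply: le_trans (qf y); rewrite lee_fin; apply: le_trans (qC y).
have vy := inner_le v (y - x).
have cc := ler_norm c.
set w := `|y - x| in dy vy *; have w_ge0 : 0 <= w := normr_ge0 _.
have h1 : `|v| * w <= `|v| / d * w ^+ 2.
  rewrite -mulrA ler_wpM2l // expr2 mulrA ler_peMl // mulrC.
  by rewrite ler_pdivlMr // mul1r.
have h2 : C + `|c| <= (C + `|c|) / d ^+ 2 * w ^+ 2.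
  rewrite -mulrA ler_peMr ?addr_ge0 // mulrC ler_pdivlMr ?exprn_gt0 // mul1r.
  by rewrite lerXn2r // nnegrE // ltW.
have : 0 <= w ^+ 2 by rewrite sqr_ge0.
lra.
Qed.

Lemma prox_objective_shift f a x v y : 0 < a ->
  prox_objective f a (x + a *: v) y =
  (f y + ((2 * a)^-1 * `|y - x| ^+ 2 - inner v (y - x) +
          `|v| ^+ 2 / 2 * a)%:E)%E.
Proof.
move=> a_gt0; rewrite /prox_objective opprD addrA. rewrite (normB_sqr (y - x)). rewrite innerZl normrZ.
congr (_ + _%:E)%E; rewrite gtr0_norm //.
by field; rewrite gt_eqF.
Qed.

Lemma le_prox_objective f a x v y c : 0 < a ->
  ((c + `|v| ^+ 2 / 2 * a)%:E <= prox_objective f a (x + a *: v)%R y)%E =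
  ((c + inner v (y - x) - (2 * a)^-1 * `|y - x| ^+ 2)%R%:E <= f y)%E.
Proof.
move=> a_gt0; rewrite prox_objective_shift //.
rewrite -leeBlDr // -EFinB; congr (_%:E <= _)%E; ring.
Qed.

(** The dictionary behind both equivalences: the envelope is tested against a global quadratic
    minorant of slope [v] at [x]. The constant [c] is left free because the Fréchet case lowers it
    by [e * a]. *)
Lemma le_moreau_env f a x v c : 0 < a ->
  ((c + `|v| ^+ 2 / 2 * a)%:E <= moreau_env f a (x + a *: v)%R)%E <->
  forall y,
    ((c + inner v (y - x) - (2 * a)^-1 * `|y - x| ^+ 2)%R%:E <= f y)%E.
Proof.
move=> a_gt0; rewrite /moreau_env gt_eqF //; split=> [cf y|cf].
  rewrite -le_prox_objective //; apply: le_trans cf _.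
  by apply: ereal_inf_lbound; exists y.
apply/ereal_infP => _ [y _ <-]; rewrite le_prox_objective //; exact: cf.
Qed.

Lemma prox_objective_base f a x v : 0 < a ->
  prox_objective f a (x + a *: v) x = (f x + (`|v| ^+ 2 / 2 * a)%:E)%E.
Proof.
move=> a_gt0; rewrite prox_objective_shift // subrr normr0 linear0r.
by congr (_ + _%:E)%E; rewrite expr0n /= mulr0 subrr add0r.
Qed.

Lemma moreau_env_le f a x v : 0 < a ->
  (moreau_env f a (x + a *: v)%R <= f x + (`|v| ^+ 2 / 2 * a)%:E)%E.
Proof.
move=> a_gt0; rewrite -prox_objective_base // /moreau_env gt_eqF //.
by apply: ereal_inf_lbound; exists x.
Qed.

Lemma prox_mapP f a x v c : 0 < a -> f x = c%:E ->
  x \in prox_map f a (x + a *: v) <->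
  ((c + `|v| ^+ 2 / 2 * a)%:E <= moreau_env f a (x + a *: v)%R)%E.
Proof.
move=> a_gt0 fx; rewrite inE /prox_map /argmin /= prox_objective_base // fx.
rewrite le_moreau_env // -EFinD.
by split=> H y; have := H y; rewrite le_prox_objective.
Qed.

Lemma prox_subdiffP f x v c : prox_bounded f -> f x = c%:E ->
  v \in prox_subdiff f x <->
  exists2 a, 0 < a &
    ((c + `|v| ^+ 2 / 2 * a)%:E <= moreau_env f a (x + a *: v)%R)%E.
Proof.
move=> f_pb fx; rewrite inE; split=> [[r [d [r_gt0 d_gt0 fr]]]|[a a_gt0]].
  have [K K_gt0 fK] := prox_bounded_minorant x v c f_pb d_gt0.
  (* Chosen so that 1/(2a) = r/2 + K, which exceeds both the coefficient valid near [x] and the one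
     valid far away. *)
  exists (r + 2 * K)^-1; first by rewrite invr_gt0 addr_gt0 // mulr_gt0.
  apply/le_moreau_env; first by rewrite invr_gt0 addr_gt0 // mulr_gt0.
  have -> : (2 * (r + 2 * K)^-1)^-1 = r / 2 + K.
    by field; rewrite gt_eqF // addr_gt0 // mulr_gt0.
  move=> y; have w2 : 0 <= `|y - x| ^+ 2 by rewrite sqr_ge0.
  have [yd|/ltW yd] := leP `|y - x| d.
    apply: le_trans (fr y yd); rewrite fx -EFinD lee_fin.
    rewrite mulrDl; have := mulr_ge0 (ltW K_gt0) w2; lra.
  apply: le_trans (fK y yd); rewrite lee_fin.
  rewrite mulrDl; have := mulr_ge0 (ltW r_gt0) w2; lra.
move=> /le_moreau_env-/(_ a_gt0) fa; exists a^-1, 1; split=> // [|y _].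
  by rewrite invr_gt0.
apply: le_trans (fa y); rewrite fx -EFinD lee_fin invfM; lra.
Qed.

Lemma frechet_subdiffP f x v c : (forall y, f y != -oo%E) -> f x = c%:E ->
  v \in frechet_subdiff f x <->
  forall e, 0 < e -> \forall y \near x,
    ((c + inner v (y - x) - e * `|y - x|)%:E <= f y)%E.
Proof.
move=> f_Noo fx; rewrite inE; split=> [[h /eqoP ho fh] e e_gt0|fe].
  near=> y; have hy : `|h y| <= e * `| `|y - x| | by near: y; exact: ho.
  have fy : (f x + (inner v (y - x) + h y)%:E <= f y)%E by near: y.
  apply: le_trans fy; rewrite fx -EFinD lee_fin.
  move: hy; rewrite normr_id ler_norml => /andP[hy _]; lra.
(* The nonpositive part of the excess of [f] over its affine model. The default 0 is right at [+oo];
   at [-oo] the inequality would fail, and [f_Noo] excludes that value. *)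
pose h y := if f y is r%:E then Num.min 0 (r - c - inner v (y - x)) else 0.
exists h; last first.
  near=> y; rewrite fx -EFinD /h.
  have := f_Noo y; case: (f y) => [r| |] //= _; last by rewrite leey.
  rewrite lee_fin -lerBrDl -lerBrDl ge_min; apply/orP; right; lra.
apply/eqoP => e e_gt0; near=> y; rewrite /= normr_id.
have ew_ge0 : 0 <= e * `|y - x| by rewrite mulr_ge0 // ltW.
have : ((c + inner v (y - x) - e * `|y - x|)%:E <= f y)%E.
  by near: y; exact: fe.
rewrite /h; case: (f y) => [r| |]; rewrite ?normr0 // lee_fin => H.
rewrite /Num.min; case: ifP => rc; first by rewrite normr0.
rewrite ler_norml; apply/andP; split; first lra.
by apply: le_trans ew_ge0; rewrite leNgt rc.
Unshelve. all: by end_near. Qed.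

End variational.

(** The upper bound on [phi] keeps the difference quotient at most [l] for every [a > 0], so
    convergence to [l] only requires a lower estimate. *)
Lemma has_right_derivative0P {R : realType} (phi : R -> \bar R) (c l : R) :
    phi 0 = c%:E -> (forall a, 0 < a -> (phi a <= (c + l * a)%:E)%E) ->
  has_right_derivative0 phi l%:E <->
  forall e, 0 < e -> \forall a \near 0^'+, ((c - e * a + l * a)%:E <= phi a)%E.
Proof.
move=> phi0 phi_le; rewrite /has_right_derivative0 phi0; split=> [dphi e e_gt0|He].
  have /dphi : nbhs l%:E [set y | ((l - e)%:E < y)%E].
    apply: open_nbhs_nbhs; split; first exact: open_ereal_gt_ereal.
    by rewrite /= lte_fin ltrBlDr ltrDl.
  rewrite nbhs_simpl /= => dphi'; near=> a.
  have a_gt0 : 0 < a by near: a; exact: nbhs_right_gt.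
  have : ((l - e)%:E < (phi a - c%:E) * (a^-1)%:E)%E by near: a; exact: dphi'.
  case: (phi a) => [r| |] /=; rewrite ?leey //.
    rewrite -EFinB -EFinM lte_fin lee_fin ltr_pdivlMr // => H; lra.
  by rewrite gt0_mulNye // lte_fin invr_gt0.
move=> A; rewrite /= /nbhs /= => /nbhs_ballP[e /= e_gt0 eA].
(* Halving turns the weak lower estimate into the strict inequality defining the ball. *)
have e2_gt0 : 0 < e / 2 by rewrite divr_gt0.
near=> a; have a_gt0 : 0 < a by near: a; exact: nbhs_right_gt.
have : ((c - e / 2 * a + l * a)%:E <= phi a)%E by near: a; exact: He.
have := phi_le a a_gt0; rewrite /=.
case: (phi a) => [r| |] //; rewrite !lee_fin => rl rg.
rewrite -EFinB -EFinM; apply: eA; rewrite /ball /= ltr_norml.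
have [q rE] : exists q, r = c + q * a.
  by exists ((r - c) / a); field; rewrite gt_eqF.
have -> : (r - c) / a = q by rewrite rE; field; rewrite gt_eqF.
move: rl rg; rewrite rE -addrA !lerD2l -mulNr -mulrDl !ler_pM2r // => rl rg.
lra.
Unshelve. all: by end_near. Qed.

Theorem lemma2p1 (R : realType) (E : euclideanType R) (f : E -> \bar R)
    (f_lsc : lower_semicontinuous f) (f_pb : prox_bounded f)
    (x : E) (fx_fin : f x \is a fin_num) (v : E)
    (phi : R -> \bar R)
    (phiE : forall a : R, 0 <= a -> phi a = moreau_env f a (x + a *: v)) :
  (v \in frechet_subdiff f x <->
     has_right_derivative0 phi (`|v| ^+ 2 / 2)%:E)
  /\
  [/\ v \in prox_subdiff f x <->
        exists2 a : R, 0 < a & x \in prox_map f a (x + a *: v),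
      forall a : R, 0 < a ->
        (x \in prox_map f a (x + a *: v) <->
         phi a = (f x + (`|v| ^+ 2 / 2 * a)%:E)%E) &
      forall a : R, 0 < a -> phi a = (f x + (`|v| ^+ 2 / 2 * a)%:E)%E ->
        forall a' : R, 0 <= a' <= a ->
          phi a' = (f x + (`|v| ^+ 2 / 2 * a')%:E)%E].
Proof.
have [c fx] : exists c, f x = c%:E by exists (fine (f x)); rewrite fineK.
have phi0 : phi 0 = c%:E by rewrite phiE // /moreau_env eqxx scale0r addr0.
have phi_le a : 0 < a -> (phi a <= (c + `|v| ^+ 2 / 2 * a)%:E)%E.
  move=> a_gt0; rewrite phiE ?(ltW a_gt0) // EFinD -fx; exact: moreau_env_le.
have phi_eq a : 0 < a ->
    phi a = (c + `|v| ^+ 2 / 2 * a)%:E <->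
    ((c + `|v| ^+ 2 / 2 * a)%:E <= moreau_env f a (x + a *: v)%R)%E.
  move=> a_gt0; rewrite -phiE ?(ltW a_gt0) //; split=> [->//|H].
  by apply/eqP; rewrite eq_le phi_le.
split.
  rewrite (has_right_derivative0P phi0 phi_le).
  have f_Noo y : f y != -oo%E.
    by case: f_pb => q _ /(_ y); case: (f y).
  rewrite (frechet_subdiffP v f_Noo fx); split=> H e e_gt0.
    (* With [s = sqrt (2 e)], AM-GM gives [s |w| <= |w|^2 / (2 a) + e a]. *)
    pose s := Num.sqrt (2 * e).
    have s_gt0 : 0 < s by rewrite sqrtr_gt0 mulr_gt0.
    have sE : s ^+ 2 = 2 * e by rewrite sqr_sqrtr // mulr_ge0 // ltW.
    have /nbhs_normP[d /= d_gt0 fd] := H s s_gt0.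
    have [K K_gt0 fK] := prox_bounded_minorant x v c f_pb d_gt0.
    near=> a; have a_gt0 : 0 < a by near: a; exact: nbhs_right_gt.
    rewrite phiE ?(ltW a_gt0) //; apply/le_moreau_env => // y.
    have w2 : 0 <= `|y - x| ^+ 2 by rewrite sqr_ge0.
    have ea : 0 < e * a by rewrite mulr_gt0.
    have [yd|yd] := ltP `|y - x| d.
      have yd' : `|x - y| < d by rewrite distrC.
      apply: le_trans (fd y yd'); rewrite lee_fin.
      have : 0 <= (2 * a)^-1 * (`|y - x| - s * a) ^+ 2.
        by rewrite mulr_ge0 ?sqr_ge0 // invr_ge0 mulr_ge0 // ltW.
      have -> : (2 * a)^-1 * (`|y - x| - s * a) ^+ 2 =
          (2 * a)^-1 * `|y - x| ^+ 2 - s * `|y - x| + s ^+ 2 / 2 * a.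
        by field; rewrite gt_eqF.
      rewrite sE; lra.
    apply: le_trans (fK y yd); rewrite lee_fin.
    (* Away from [x], it is enough that a < 1/(2K). *)
    have : K <= (2 * a)^-1.
      rewrite -[K]invrK lef_pV2 ?posrE ?invr_gt0 ?mulr_gt0 //.
      rewrite -ler_pdivlMl //; apply: ltW; near: a; apply: nbhs_right_lt.
      by rewrite mulr_gt0 // invr_gt0.
    move=> /(ler_wpM2r w2); lra.
  (* At a given [y], the choice [a = |y - x| / (e / 2)] balances [(e / 2)^2 a]
     and [|y - x|^2 / (2 a)]. *)
  have e2_gt0 : 0 < (e / 2) ^+ 2 by rewrite exprn_gt0 // divr_gt0.
  have := H _ e2_gt0; rewrite /at_right /= near_withinE.
  move=> /nbhs_normP[d /= d_gt0 Hd]; apply/nbhs_normP.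
  (* This radius guarantees that the [a] chosen below is less than [d]. The point [y = x] is treated
     apart, since it would give [a = 0]. *)
  exists (e / 2 * d); first by rewrite /= !mulr_gt0 // invr_gt0.
  move=> y; rewrite /= distrC => yd.
  have [->|yx] := eqVneq y x.
    by rewrite subrr normr0 linear0r mulr0 subr0 addr0 fx.
  have w_gt0 : 0 < `|y - x| by rewrite normr_gt0 subr_eq0.
  pose a := `|y - x| / (e / 2).
  have a_gt0 : 0 < a by rewrite !divr_gt0.
  have ad : `|0 - a| < d.
    by rewrite sub0r normrN gtr0_norm // ltr_pdivrMr ?divr_gt0 // mulrC.
  have := Hd a ad a_gt0.
  rewrite phiE ?(ltW a_gt0) // => /le_moreau_env -/(_ a_gt0 y).
  apply: le_trans; rewrite lee_fin.
  have -> : (e / 2) ^+ 2 * a = e / 2 * `|y - x|.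
    by rewrite /a; field; rewrite gt_eqF.
  have -> : (2 * a)^-1 * `|y - x| ^+ 2 = e / 4 * `|y - x|.
    by rewrite /a; field; rewrite !gt_eqF.
  (* The two losses, e/2 and e/4 times |y - x|, add up to less than e |y - x|. *)
  have := mulr_gt0 e_gt0 w_gt0; lra.
split=> [|a a_gt0|a a_gt0].
- rewrite (prox_subdiffP v f_pb fx).
  by split=> -[a a_gt0 H]; exists a => //; apply/(prox_mapP v a_gt0 fx).
- by rewrite (prox_mapP v a_gt0 fx) fx -EFinD phi_eq.
rewrite fx -EFinD => /(phi_eq a a_gt0)/(le_moreau_env _ _ _ _ a_gt0) fa a'.
move=> /andP[]; rewrite le_eqVlt => /predU1P[<- _|a'_gt0 a'a].
  by rewrite mulr0 adde0 phi0.
(* Decreasing [a] increases the coefficient 1/(2a), so the minorant for [a] lies above the one for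
   [a']. *)
rewrite -EFinD; apply/phi_eq => //; apply/le_moreau_env => // y.
apply: le_trans (fa y); rewrite lee_fin lerD2l lerN2 ler_wpM2r ?sqr_ge0 //.
by rewrite lef_pV2 ?posrE ?mulr_gt0 // ler_pM2l.
Unshelve. all: by end_near. Qed.
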